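(* Let $\Omega_1$ and $\Omega_2$ be two open subsets of $\bigwedge^p V$ with $\Omega_1\cap\Omega_2\neq\emptyset$. Let $F:\Omega_1\to\bigwedge^q V$ and $G:\Omega_2\to\bigwedge^q V$ be two functions that are differentiable at $X_0\in\Omega_1\cap\Omega_2$, and denote their differentials at $X_0$ by $f_{X_0}$ and $g_{X_0}$, respectively. Then the sum $F+G:\Omega_1\cap\Omega_2\to\bigwedge^q V$, $(F+G)(X)=F(X)+G(X)$, and the products $F\ast G:\Omega_1\cap\Omega_2\to\bigwedge V$, $(F\ast G)(X)=F(X)\ast G(X)$, where $\ast$ is any one of the exterior product $\wedge$, the scalar product $\cdot$, the left contraction $\lrcorner$, the right contraction $\llcorner$, or the Clifford product, are also differentiable at $X_0$. The differential of $F+G$ at $X_0$ is $f_{X_0}+g_{X_0}$, and the differential of $F\ast G$ at $X_0$ is the linear map $$A\mapsto f_{X_0}(A)\ast G(X_0)+F(X_0)\ast g_{X_0}(A),\qquad A\in\textstyle\bigwedge^p V.$$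
   Context: $V$ is a finite-dimensional real vector space of dimension $n$ with a fixed Euclidean (positive definite) scalar product; $\bigwedge V=\bigoplus_{k=0}^n\bigwedge^k V$ is the space of multivectors, with $\bigwedge^0V=\mathbb{R}$, and $p,q\in\{0,\dots,n\}$. The scalar product extends to multivectors by $(v_1\wedge\dots\wedge v_k)\cdot(w_1\wedge\dots\wedge w_k)=\det(v_i\cdot w_j)$, $\alpha\cdot\beta=\alpha\beta$ for scalars, with different grades orthogonal; the norm is $\|X\|=\sqrt{X\cdot X}$. With $\widetilde{X}$ denoting reversion, the left and right contractions are defined by $(X\lrcorner Y)\cdot Z=Y\cdot(\widetilde{X}\wedge Z)$ and $(X\llcorner Y)\cdot Z=X\cdot(Z\wedge\widetilde{Y})$ for all $Z$; the Clifford product is the associative bilinear unital product on $\bigwedge V$ (scalars acting by scalar multiplication) with $vX=v\lrcorner X+v\wedge X$ for $v\in V$, $X\in\bigwedge V$. Limits are with respect to $\|\cdot\|$, and open subsets of $\bigwedge^pV$ are those all of whose points are interior with respect to $\|\cdot\|$ restricted to $\bigwedge^p V$. A $(p,q)$-extensor is a linear map $\bigwedge^p V\to\bigwedge^q V$. A function $F:\Omega\to\bigwedge^q V$ with $\Omega\subseteq\bigwedge^pV$ is differentiable at $X_0\in\Omega$ if there is a $(p,q)$-extensor $f_{X_0}$ with $$\lim_{X\to X_0}\frac{F(X)-F(X_0)-f_{X_0}(X-X_0)}{\|X-X_0\|}=0;$$ it is (for $\Omega$ open) unique and called the differential of $F$ at $X_0$. For functions $\Omega\to\bigwedge V$ the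 same definition is used, with the differential being a linear map $\bigwedge^pV\to\bigwedge V$. *)

(* Defs.v *)
From HB Require Import structures.
From mathcomp Require Import all_boot all_order all_algebra.
From mathcomp Require Import sesquilinear reals ring zify.

Set Implicit Arguments.
Unset Strict Implicit.
Unset Printing Implicit Defensive.

Import Order.TTheory GRing.Theory Num.Theory.

Local Open Scope ring_scope.

Section OrthonormalBasis.
Context {R : realType} {V : vectType R} (g : {dot V for idfun}).

Lemma dotC u v : g u v = g v u.
Proof. by have := hermC g u v; rewrite expr0 mul1r. Qed.

Lemma dotZl a u v : g (a *: u) v = a * g u v.
Proof. exact: linearZl_LR. Qed.

Lemma dotZr a u v : g u (a *: v) = a * g u v.
Proof. by rewrite dotC dotZl dotC. Qed.

Lemma dotDl u v w : g (u + v) w = g u w + g v w.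
Proof. exact: linearDl. Qed.

Lemma dotBl u v w : g (u - v) w = g u w - g v w.
Proof. exact: linearBl. Qed.

Lemma dot0l v : g 0 v = 0.
Proof. exact: linear0l. Qed.

Lemma dot_suml I r (P : pred I) F v :
  g (\sum_(i <- r | P i) F i) v = \sum_(i <- r | P i) g (F i) v.
Proof. exact: linear_sumlz. Qed.

Definition is_orthonormal k (e : 'I_k -> V) :=
  [forall i, [forall j, g (e i) (e j) == (i == j)%:R]].

Lemma is_orthonormalP k (e : 'I_k -> V) :
  reflect (forall i j, g (e i) (e j) = (i == j)%:R) (is_orthonormal e).
Proof.
apply: (iffP forallP) => [H i j|H i]; first by move/forallP/(_ j)/eqP: (H i).
by apply/forallP => j; rewrite H.
Qed.

Lemma dot_sum_orthonormal k (e : 'I_k -> V) (c : 'I_k -> R) j :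
  is_orthonormal e -> g (\sum_i c i *: e i) (e j) = c j.
Proof.
move/is_orthonormalP => He; rewrite dot_suml (bigD1 j) //= dotZl He eqxx mulr1.
by rewrite big1 ?addr0 // => i /negPf ij; rewrite dotZl He ij mulr0.
Qed.

Lemma orthonormal_free k (e : k.-tuple V) : is_orthonormal (tnth e) -> free e.
Proof.
move=> He; apply/freeP => c.
under eq_bigr do rewrite -tnth_nth.
move=> E i.
by have := dot_sum_orthonormal c i He; rewrite E dot0l.
Qed.

Lemma orthonormal_extend k (e : 'I_k -> V) : is_orthonormal e -> (k < \dim {:V})%N ->
  exists e' : 'I_k.+1 -> V, is_orthonormal e'.
Proof.
move=> He kn; pose s := [tuple e i | i < k].
have [v Hv]: exists v, v \notin <<s>>%VS.
  have /subvPn[v _ Hv]: ~~ ({:V} <= <<s>>)%VS.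
    apply/negP => /dimvS; rewrite leqNgt => /negP; apply.
    by apply: leq_ltn_trans kn; rewrite -[X in (_ <= X)%N](size_tuple s) dim_span.
  by exists v.
pose w := v - \sum_i g v (e i) *: e i.
have w0 : w != 0.
  apply: contraNneq Hv => /eqP; rewrite subr_eq0 => /eqP ->.
  apply: memv_suml => i _; apply/memvZ/memv_span/mapP; exists i => //.
  by rewrite mem_enum.
have we i : g w (e i) = 0 by rewrite dotBl dot_sum_orthonormal // subrr.
have gw : 0 < g w w by apply: neq0_dnorm_gt0.
pose u := (Num.sqrt (g w w))^-1 *: w.
have ue i : g u (e i) = 0 by rewrite dotZl we mulr0.
have uu : g u u = 1.
  rewrite dotZl dotZr mulrA -invfM -expr2 sqr_sqrtr ?ltW //.
  by rewrite mulVf // gt_eqF.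
exists (fun i => oapp e u (unlift ord_max i)).
apply/is_orthonormalP => i j; move/is_orthonormalP: He => He.
case: (unliftP ord_max i) => [i'|] ->; case: (unliftP ord_max j) => [j'|] -> /=.
- by rewrite He (inj_eq lift_inj).
- by rewrite dotC ue [_ == _]eq_sym (negPf (neq_lift _ _)).
- by rewrite ue (negPf (neq_lift _ _)).
- by rewrite uu eqxx.
Qed.

Lemma onb_exists : exists e : (\dim {:V}).-tuple V, is_orthonormal (tnth e).
Proof.
suff H k : (k <= \dim {:V})%N -> exists e : 'I_k -> V, is_orthonormal e.
  have [e /is_orthonormalP He] := H _ (leqnn _).
  exists [tuple e i | i < \dim {:V}]; apply/is_orthonormalP => i j.
  by rewrite !tnth_mktuple He.
elim: k => [|k IH] kn; last by have [e He] := IH (ltnW kn); exact: orthonormal_extend He kn.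
by exists (fun _ => 0); apply/is_orthonormalP => -[].
Qed.

Definition onb : 'I_(\dim {:V}) -> V := tnth (xchoose onb_exists).

Lemma onbE i j : g (onb i) (onb j) = (i == j)%:R.
Proof. exact/is_orthonormalP/(xchooseP onb_exists). Qed.

Lemma onb_expand v : v = \sum_i g v (onb i) *: onb i.
Proof.
rewrite /onb; move: (xchoose _) (xchooseP onb_exists) => e He.
have vs : v \in <<e>>%VS.
  suff /eqP -> : <<e>>%VS == {:V}%VS by rewrite memvf.
  by rewrite eqEdim subvf /= (eqP (orthonormal_free He)) size_tuple.
rewrite {1}(coord_span vs); apply: eq_bigr => i _; rewrite -tnth_nth; congr (_ *: _).
rewrite [in RHS](coord_span vs); under [in RHS]eq_bigr do rewrite -tnth_nth.
by rewrite dot_sum_orthonormal.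
Qed.

Lemma dot_onb u v : g u v = \sum_i g u (onb i) * g v (onb i).
Proof.
rewrite {1}(onb_expand u) dot_suml; apply: eq_bigr => i _.
by rewrite dotZl [in RHS](dotC v).
Qed.

End OrthonormalBasis.

(* Multivectors in coordinates: X I is the coefficient of e_i1 /\ ... /\ e_ik,
   where I = {i1 < ... < ik} and e is the orthonormal basis [onb g] of V; see
   [blade_wedges]. *)
Definition multivector (R : realType) (V : vectType R) (g : {dot V for idfun}) :=
  {ffun {set 'I_(\dim {:V})} -> R^o}.

HB.instance Definition _ (R : realType) (V : vectType R) (g : {dot V for idfun}) :=
  Vector.on (multivector g).

Section Multivectors.
Context {R : realType} {V : vectType R} {g : {dot V for idfun}}.
Local Notation n := (\dim {:V}).
Local Notation mv := (multivector g).
Implicit Types (I J K : {set 'I_n}) (X Y Z : mv) (i j : 'I_n) (v w : V).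

Definition blade I : mv := [ffun J => (J == I)%:R].

Definition mvscalar (a : R) : mv := a *: blade set0.

Definition mvvec v : mv := \sum_i g v (onb g i) *: blade [set i].

Definition bilext (c : {set 'I_n} -> {set 'I_n} -> mv) X Y : mv :=
  \sum_I \sum_J (X I * Y J) *: c I J.

(* (-1) to the number of inversions in the concatenation of I and J. *)
Definition shuffle_sign I J : R :=
  \prod_(i in I) \prod_(j in J | (j < i)%N) (-1).

Definition symdiff I J := (I :\: J) :|: (J :\: I).

(* Associative and unital with v /\ v = 0: [wedgeA], [wedge1l], [wedge_vec_vec]. *)
Definition wedge : mv -> mv -> mv :=
  bilext (fun I J => if [disjoint I & J] then shuffle_sign I J *: blade (I :|: J) else 0).

(* The product generated by e_i e_i = 1 and e_i e_j = - e_j e_i for i != j. It is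
   the only bilinear, associative and unital product such that
   v X = v _| X + v /\ X: [cliffordA], [clifford_scalarl], [clifford_vec],
   [clifford_unique]. *)
Definition clifford : mv -> mv -> mv :=
  bilext (fun I J => shuffle_sign I J *: blade (symdiff I J)).

(* (v_1 /\ ... /\ v_k) . (w_1 /\ ... /\ w_k) = det (g v_i w_j), and different
   grades are orthogonal: [mvdot_wedges], [mvdot_grade], [mvdot_scalar]. *)
Definition mvdot X Y : R := \sum_I X I * Y I.

Definition mvnorm X : R := Num.sqrt (mvdot X X).

(* The reversal of v_1 /\ ... /\ v_k is v_k /\ ... /\ v_1: [reversion_wedges]. *)
Definition reversion X : mv := [ffun I : {set 'I_n} => (-1) ^+ 'C(#|I|, 2) * X I].

(* Since the blades are orthonormal, these are the coordinates of the multivectors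
   with (lcontr X Y) . Z = Y . (~X /\ Z) and (rcontr X Y) . Z = X . (Z /\ ~Y) for
   all Z, where ~ is the reversion: [lcontrP], [rcontrP], [mvdot_inj]. *)
Definition lcontr X Y : mv := [ffun K => mvdot Y (wedge (reversion X) (blade K))].

Definition rcontr X Y : mv := [ffun K => mvdot X (wedge (blade K) (reversion Y))].

(* The multivectors whose coefficients vanish off the sets of cardinal k:
   [memv_gradeP], [mvwedges_grade]. *)
Definition grade (k : nat) : {vspace mv} := 
  (\sum_(I : {set 'I_n} | #|I| == k) <[blade I]>)%VS.

Definition mvwedges (s : seq V) : mv := foldr (fun v => wedge (mvvec v)) (mvscalar 1) s.

Lemma mvD X Y I : (X + Y) I = X I + Y I. Proof. by rewrite ffunE. Qed.
Lemma mvZ a X I : (a *: X) I = a * X I. Proof. by rewrite ffunE. Qed.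
Lemma mv0 I : (0 : mv) I = 0. Proof. by rewrite ffunE. Qed.
Lemma mv_sum (T : Type) (r : seq T) (P : pred T) (F : T -> mv) I :
  (\sum_(t <- r | P t) F t) I = \sum_(t <- r | P t) F t I.
Proof. by elim/big_rec2: _ => [|t y1 y2 _ <-]; rewrite ?mv0 ?mvD. Qed.
Lemma bladeE I J : blade I J = (J == I)%:R. Proof. by rewrite ffunE. Qed.

Lemma mv_expand X : X = \sum_I X I *: blade I.
Proof.
apply/ffunP => J; rewrite mv_sum (bigD1 J) //= mvZ bladeE eqxx mulr1.
by rewrite big1 ?addr0 // => I /negPf IJ; rewrite mvZ bladeE eq_sym IJ mulr0.
Qed.

Section Bilext.
Variable c : {set 'I_n} -> {set 'I_n} -> mv.

Lemma bilext_bilinear : bilinear_for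
  (GRing.Scale.Law.clone _ _ *:%R _) (GRing.Scale.Law.clone _ _ *:%R _) (bilext c).
Proof.
split=> Z a X Y /=; rewrite /bilext scaler_sumr -big_split /=; apply: eq_bigr => I _;
  rewrite scaler_sumr -big_split /=; apply: eq_bigr => J _;
  by rewrite scalerA -scalerDl mvD mvZ ?mulrDl ?mulrDr mulrA // [_ * a]mulrC mulrA.
Qed.

HB.instance Definition _ := bilinear_isBilinear.Build R mv mv mv _ _ (bilext c) bilext_bilinear.

Lemma bilext_blade I J : bilext c (blade I) (blade J) = c I J.
Proof.
rewrite /bilext (bigD1 I) //= (bigD1 J) //= !bladeE !eqxx mulr1 scale1r.
rewrite big1 ?big1 ?addr0 // => [I' /negPf E|J' /negPf E].
  by rewrite big1 // => J' _; rewrite bladeE E mul0r scale0r.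
by rewrite !bladeE E mulr0 scale0r.
Qed.
End Bilext.

HB.instance Definition _ := Bilinear.copy wedge (bilext _).
HB.instance Definition _ := Bilinear.copy clifford (bilext _).


Lemma mv_lin_ind (P : mv -> Prop) :
  (forall a X Y, P X -> P Y -> P (a *: X + Y)) -> (forall I, P (blade I)) -> forall X, P X.
Proof.
move=> Plin Pb X; have P0 : P 0.
  by rewrite -(addNr (blade set0)) -scaleN1r; apply: Plin; apply: Pb.
rewrite (mv_expand X); elim/big_rec: _ => // I Y _ PY; exact: Plin.
Qed.

Lemma wedgePl a X Y Z : wedge (a *: X + Y) Z = a *: wedge X Z + wedge Y Z.
Proof. exact: (linearPl (wedge : {bilinear mv -> mv -> mv})). Qed.
Lemma wedgePr a X Y Z : wedge Z (a *: X + Y) = a *: wedge Z X + wedge Z Y.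
Proof. exact: (linearPr (wedge : {bilinear mv -> mv -> mv})). Qed.
Lemma cliffordPl a X Y Z : clifford (a *: X + Y) Z = a *: clifford X Z + clifford Y Z.
Proof. exact: (linearPl (clifford : {bilinear mv -> mv -> mv})). Qed.
Lemma cliffordPr a X Y Z : clifford Z (a *: X + Y) = a *: clifford Z X + clifford Z Y.
Proof. exact: (linearPr (clifford : {bilinear mv -> mv -> mv})). Qed.

Lemma mvdotC X Y : mvdot X Y = mvdot Y X.
Proof. by apply: eq_bigr => I _; rewrite mulrC. Qed.
Lemma mvdotPl a X Y Z : mvdot (a *: X + Y) Z = a * mvdot X Z + mvdot Y Z.
Proof.
rewrite /mvdot mulr_sumr -big_split; apply: eq_bigr => I _ /=.
by rewrite mvD mvZ mulrDl mulrA.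
Qed.
Lemma mvdotPr a X Y Z : mvdot Z (a *: X + Y) = a * mvdot Z X + mvdot Z Y.
Proof. by rewrite mvdotC mvdotPl !(mvdotC Z). Qed.
Lemma mvdot_blader X I : mvdot X (blade I) = X I.
Proof.
rewrite /mvdot (bigD1 I) //= bladeE eqxx mulr1 big1 ?addr0 // => J /negPf JI.
by rewrite bladeE JI mulr0.
Qed.
Lemma mvdot_bladel X I : mvdot (blade I) X = X I.
Proof. by rewrite mvdotC mvdot_blader. Qed.

Lemma reversionP a X Y : reversion (a *: X + Y) = a *: reversion X + reversion Y.
Proof. by apply/ffunP => I; rewrite !ffunE mulrDr mulrCA. Qed.

Lemma lcontrPl a X Y Z : lcontr (a *: X + Y) Z = a *: lcontr X Z + lcontr Y Z.
Proof. by apply/ffunP => I; rewrite mvD mvZ !ffunE reversionP wedgePl mvdotPr. Qed.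
Lemma lcontrPr a X Y Z : lcontr Z (a *: X + Y) = a *: lcontr Z X + lcontr Z Y.
Proof. by apply/ffunP => I; rewrite mvD mvZ !ffunE mvdotPl. Qed.
Lemma rcontrPl a X Y Z : rcontr (a *: X + Y) Z = a *: rcontr X Z + rcontr Y Z.
Proof. by apply/ffunP => I; rewrite mvD mvZ !ffunE mvdotPl. Qed.
Lemma rcontrPr a X Y Z : rcontr Z (a *: X + Y) = a *: rcontr Z X + rcontr Z Y.
Proof. by apply/ffunP => I; rewrite mvD mvZ !ffunE reversionP wedgePr mvdotPr. Qed.

Lemma wedge0l X : wedge 0 X = 0.
Proof. exact: (linear0l (wedge : {bilinear mv -> mv -> mv})). Qed.
Lemma wedge0r X : wedge X 0 = 0.
Proof. exact: (linear0r (wedge : {bilinear mv -> mv -> mv})). Qed.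
Lemma wedgeZl a X Y : wedge (a *: X) Y = a *: wedge X Y.
Proof. exact: (linearZl_LR (wedge : {bilinear mv -> mv -> mv})). Qed.
Lemma wedgeZr a X Y : wedge X (a *: Y) = a *: wedge X Y.
Proof. exact: (linearZr_LR (wedge : {bilinear mv -> mv -> mv})). Qed.
Lemma cliffordZl a X Y : clifford (a *: X) Y = a *: clifford X Y.
Proof. exact: (linearZl_LR (clifford : {bilinear mv -> mv -> mv})). Qed.
Lemma cliffordZr a X Y : clifford X (a *: Y) = a *: clifford X Y.
Proof. exact: (linearZr_LR (clifford : {bilinear mv -> mv -> mv})). Qed.

Lemma wedge_blade I J : wedge (blade I) (blade J) =
  if [disjoint I & J] then shuffle_sign I J *: blade (I :|: J) else 0.
Proof. exact: bilext_blade. Qed.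
Lemma clifford_blade I J :
  clifford (blade I) (blade J) = shuffle_sign I J *: blade (symdiff I J).
Proof. exact: bilext_blade. Qed.

Lemma in_symdiff I J i : (i \in symdiff I J) = (i \in I) (+) (i \in J).
Proof. by rewrite !inE; case: (i \in I); case: (i \in J). Qed.

Lemma prod_symdiff (h : 'I_n -> R) I J : (forall i, h i * h i = 1) ->
  \prod_(i in symdiff I J) h i = (\prod_(i in I) h i) * \prod_(i in J) h i.
Proof.
move=> hh; rewrite !(big_mkcond (fun i => i \in _)) -big_split /=.
apply: eq_bigr => i _; rewrite in_symdiff.
by case: (i \in I); case: (i \in J); rewrite ?hh ?mulr1 ?mul1r.
Qed.

Lemma symdiffA I J K : symdiff (symdiff I J) K = symdiff I (symdiff J K).
Proof. by apply/setP => i; rewrite !in_symdiff addbA. Qed.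
Lemma symdiff0s I : symdiff set0 I = I.
Proof. by apply/setP => i; rewrite in_symdiff inE. Qed.
Lemma symdiffs0 I : symdiff I set0 = I.
Proof. by apply/setP => i; rewrite in_symdiff inE addbF. Qed.
Lemma symdiff_disjoint I J : [disjoint I & J] -> symdiff I J = I :|: J.
Proof.
move/disjointFr => D; apply/setP => i; rewrite in_symdiff !inE.
by have := D i; case: (i \in I) => // ->.
Qed.

Lemma prod_sign2 (s : seq 'I_n) (P : pred 'I_n) :
  (\prod_(j <- s | P j) (-1 : R)) * (\prod_(j <- s | P j) (-1)) = 1.
Proof. by rewrite -big_split /= big1 // => j _; rewrite mulrNN mulr1. Qed.

Lemma shuffle_sign_symdiffl I J K :
  shuffle_sign (symdiff I J) K = shuffle_sign I K * shuffle_sign J K.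
Proof. by apply: prod_symdiff => i; apply: prod_sign2. Qed.

Lemma shuffle_sign_symdiffr I J K :
  shuffle_sign I (symdiff J K) = shuffle_sign I J * shuffle_sign I K.
Proof.
rewrite /shuffle_sign -big_split /=; apply: eq_bigr => i _.
rewrite !big_mkcondr; apply: prod_symdiff => j.
by case: ifP; rewrite ?mulrNN mulr1.
Qed.

Lemma shuffle_sign0l I : shuffle_sign set0 I = 1.
Proof. by rewrite /shuffle_sign big_set0. Qed.
Lemma shuffle_sign0r I : shuffle_sign I set0 = 1.
Proof. by rewrite /shuffle_sign big1 // => i _; rewrite big_pred0 // => j; rewrite inE. Qed.
Lemma shuffle_sign11 i j : shuffle_sign [set i] [set j] = if (j < i)%N then -1 else 1.
Proof.
rewrite /shuffle_sign big_set1 big_mkcondr big_set1 /=; by case: ifP.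
Qed.
Lemma shuffle_sign2 I J : shuffle_sign I J * shuffle_sign I J = 1.
Proof.
rewrite /shuffle_sign -big_split big1 //= => i _; exact: prod_sign2.
Qed.

Lemma wedgeA X Y Z : wedge X (wedge Y Z) = wedge (wedge X Y) Z.
Proof.
elim/mv_lin_ind: X => [a X X' IH IH'|I]; first by rewrite !wedgePl IH IH'.
elim/mv_lin_ind: Y => [a Y Y' IH IH'|J]; first by rewrite !(wedgePl, wedgePr) IH IH'.
elim/mv_lin_ind: Z => [a Z Z' IH IH'|K]; first by rewrite !wedgePr IH IH'.
rewrite !wedge_blade; case JK : [disjoint J & K]; case IJ : [disjoint I & J];
  rewrite ?wedge0l ?wedge0r ?wedgeZl ?wedgeZr ?wedge_blade //.
- have dI : [disjoint I & J :|: K] = [disjoint I & K].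
    by rewrite -!setI_eq0 setIUr setU_eq0 !setI_eq0 IJ.
  have dK : [disjoint I :|: J & K] = [disjoint I & K].
    by rewrite -!setI_eq0 setIUl setU_eq0 !setI_eq0 JK andbT.
  rewrite dI dK; case: ifP => IK; last by rewrite !scaler0.
  rewrite -(symdiff_disjoint JK) -(symdiff_disjoint IJ) in dI dK *.
  rewrite !scalerA -!symdiff_disjoint ?dI ?dK // symdiffA; congr (_ *: _).
  rewrite shuffle_sign_symdiffl shuffle_sign_symdiffr; ring.
- by case: ifP => [|_]; rewrite ?scaler0 // -setI_eq0 setIUr setU_eq0 !setI_eq0 IJ.
- by case: ifP => [|_]; rewrite ?scaler0 // -setI_eq0 setIUl setU_eq0 !setI_eq0 JK andbF.
Qed.

Lemma wedge1l X : wedge (mvscalar 1) X = X.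
Proof.
rewrite /mvscalar scale1r; elim/mv_lin_ind: X => [a X Y IX IY|I]; first by rewrite wedgePr IX IY.
by rewrite wedge_blade disjoints_subset sub0set set0U shuffle_sign0l scale1r.
Qed.
Lemma wedge1r X : wedge X (mvscalar 1) = X.
Proof.
rewrite /mvscalar scale1r; elim/mv_lin_ind: X => [a X Y IX IY|I]; first by rewrite wedgePl IX IY.
by rewrite wedge_blade disjoint_sym disjoints_subset sub0set setU0 shuffle_sign0r scale1r.
Qed.

Lemma cliffordA X Y Z : clifford X (clifford Y Z) = clifford (clifford X Y) Z.
Proof.
elim/mv_lin_ind: X => [a X X' IH IH'|I]; first by rewrite !cliffordPl IH IH'.
elim/mv_lin_ind: Y => [a Y Y' IH IH'|J]; first by rewrite !(cliffordPl, cliffordPr) IH IH'.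
elim/mv_lin_ind: Z => [a Z Z' IH IH'|K]; first by rewrite !cliffordPr IH IH'.
rewrite !clifford_blade cliffordZl cliffordZr !clifford_blade !scalerA symdiffA.
rewrite shuffle_sign_symdiffl shuffle_sign_symdiffr; congr (_ *: _).
by ring.
Qed.

Lemma clifford_scalarl a X : clifford (mvscalar a) X = a *: X.
Proof.
rewrite /mvscalar cliffordZl; congr (_ *: _).
elim/mv_lin_ind: X => [b X Y IX IY|I]; first by rewrite cliffordPr IX IY.
by rewrite clifford_blade symdiff0s shuffle_sign0l scale1r.
Qed.
Lemma clifford_scalarr a X : clifford X (mvscalar a) = a *: X.
Proof.
rewrite /mvscalar cliffordZr; congr (_ *: _).
elim/mv_lin_ind: X => [b X Y IX IY|I]; first by rewrite cliffordPl IX IY.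
by rewrite clifford_blade symdiffs0 shuffle_sign0r scale1r.
Qed.

Lemma lcontrP X Y Z : mvdot (lcontr X Y) Z = mvdot Y (wedge (reversion X) Z).
Proof.
elim/mv_lin_ind: Z => [a Z Z' IH IH'|K]; first by rewrite !(mvdotPr, wedgePr) IH IH'.
by rewrite mvdot_blader ffunE.
Qed.
Lemma rcontrP X Y Z : mvdot (rcontr X Y) Z = mvdot X (wedge Z (reversion Y)).
Proof.
elim/mv_lin_ind: Z => [a Z Z' IH IH'|K]; first by rewrite !(mvdotPr, wedgePl) IH IH'.
by rewrite mvdot_blader ffunE.
Qed.

Lemma mvdot_inj X Y : (forall Z, mvdot X Z = mvdot Y Z) -> X = Y.
Proof. by move=> H; apply/ffunP => I; rewrite -!mvdot_blader H. Qed.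

Lemma mvvecP a v w : mvvec (a *: v + w) = a *: mvvec v + mvvec w.
Proof.
rewrite /mvvec scaler_sumr -big_split; apply: eq_bigr => i _ /=.
by rewrite dotDl dotZl scalerDl scalerA.
Qed.

Lemma mvvec_onb i : mvvec (onb g i) = blade [set i].
Proof.
rewrite /mvvec (bigD1 i) //= onbE eqxx scale1r big1 ?addr0 // => j /negPf ji.
by rewrite onbE eq_sym ji scale0r.
Qed.

Lemma vec_lin_ind (P : V -> Prop) :
  (forall a v w, P v -> P w -> P (a *: v + w)) -> P 0 -> (forall i, P (onb g i)) ->
  forall v, P v.
Proof.
move=> Plin P0 Pb v; rewrite (onb_expand g v).
by elim/big_rec: _ => // I Y _ PY; apply: Plin.
Qed.

Lemma mvvec0 : mvvec 0 = 0.
Proof. by rewrite /mvvec big1 // => i _; rewrite dot0l scale0r. Qed.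

Lemma lcontr0l X : lcontr 0 X = 0.
Proof. by have := lcontrPl (-1) X X X; rewrite !scaleN1r !addNr. Qed.
Lemma lcontrZl a X Y : lcontr (a *: X) Y = a *: lcontr X Y.
Proof. by have := lcontrPl a X 0 Y; rewrite lcontr0l !addr0. Qed.
Lemma lcontr0r X : lcontr X 0 = 0.
Proof. by have := lcontrPr (-1) X X X; rewrite !scaleN1r !addNr. Qed.
Lemma lcontrZr a X Y : lcontr X (a *: Y) = a *: lcontr X Y.
Proof. by have := lcontrPr a Y 0 X; rewrite lcontr0r !addr0. Qed.
Lemma clifford0l X : clifford 0 X = 0.
Proof. by have := cliffordPl (-1) X X X; rewrite !scaleN1r !addNr. Qed.
Lemma mvdotZl a X Y : mvdot (a *: X) Y = a * mvdot X Y.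
Proof. by rewrite /mvdot mulr_sumr; apply: eq_bigr => I _; rewrite mvZ mulrA. Qed.
Lemma mvdot0l X : mvdot 0 X = 0.
Proof. by rewrite -(scale0r X) mvdotZl mul0r. Qed.
Lemma mvdotZr a X Y : mvdot X (a *: Y) = a * mvdot X Y.
Proof. by rewrite mvdotC mvdotZl mvdotC. Qed.
Lemma mvdot_sumr (T : finType) X (F : T -> mv) : mvdot X (\sum_t F t) = \sum_t mvdot X (F t).
Proof.
elim/big_rec2: _ => [|t y Y _ <-]; first by rewrite mvdotC mvdot0l.
by rewrite -[F t]scale1r mvdotPr mul1r scale1r.
Qed.
Lemma wedge_sumr (T : finType) X (F : T -> mv) : wedge X (\sum_t F t) = \sum_t wedge X (F t).
Proof. exact: (linear_sumr (wedge : {bilinear mv -> mv -> mv})). Qed.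

Lemma wedge_vecN v w : wedge (mvvec v) (mvvec w) = - wedge (mvvec w) (mvvec v).
Proof.
elim/vec_lin_ind: v => [a v v' IH IH'||i].
- by rewrite mvvecP wedgePl wedgePr IH IH' scalerN opprD.
- by rewrite mvvec0 wedge0l wedge0r oppr0.
elim/vec_lin_ind: w => [a v v' IH IH'||j].
- by rewrite mvvecP wedgePl wedgePr IH IH' scalerN opprD.
- by rewrite mvvec0 wedge0l wedge0r oppr0.
rewrite !mvvec_onb !wedge_blade !disjoints1 !inE eq_sym.
case: ifP => [ij|_]; last by rewrite oppr0.
rewrite !shuffle_sign11 setUC; case: ltngtP => [||/val_inj ji]; rewrite ?scaleN1r ?scale1r ?opprK //.
by rewrite ji eqxx in ij.
Qed.

Lemma wedge_vec_vec v : wedge (mvvec v) (mvvec v) = 0.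
Proof.
have /eqP := wedge_vecN v v; rewrite -addr_eq0 -mulr2n -scaler_nat scaler_eq0.
by rewrite pnatr_eq0 => /eqP.
Qed.

Lemma reversion_vec v : reversion (mvvec v) = mvvec v.
Proof.
elim/vec_lin_ind: v => [a v w IH IH'||i]; first by rewrite mvvecP reversionP IH IH'.
  by rewrite mvvec0; apply/ffunP => I; rewrite ffunE mv0 mulr0.
rewrite mvvec_onb; apply/ffunP => I; rewrite ffunE bladeE; case: eqP => [->|]; last by rewrite mulr0.
by rewrite cards1 mul1r.
Qed.

Lemma wedge_blade1 i K : wedge (blade [set i]) (blade K) =
  if i \in K then 0 else shuffle_sign [set i] K *: blade (i |: K).
Proof. by rewrite wedge_blade disjoints1; case: (i \in K). Qed.

Lemma shuffle_sign_ii i : shuffle_sign [set i] [set i] = 1.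
Proof. by rewrite shuffle_sign11 ltnn. Qed.

Lemma symdiff1_in i K : i \in K -> symdiff [set i] K = K :\ i.
Proof.
move=> iK; apply/setP => j; rewrite in_symdiff !inE; case: eqP => [->|//].
by rewrite iK.
Qed.
Lemma symdiff1_notin i K : i \notin K -> symdiff [set i] K = i |: K.
Proof. by move=> iK; rewrite symdiff_disjoint // disjoints1. Qed.

Lemma shuffle_sign_setD1 i j K : j \in K ->
  shuffle_sign [set i] (K :\ j) = shuffle_sign [set i] [set j] * shuffle_sign [set i] K.
Proof. by move=> jK; rewrite -symdiff1_in // shuffle_sign_symdiffr. Qed.

Lemma shuffle_sign_setU1 i j K : j \notin K ->
  shuffle_sign [set i] (j |: K) = shuffle_sign [set i] [set j] * shuffle_sign [set i] K.
Proof. by move=> jK; rewrite -symdiff1_notin // shuffle_sign_symdiffr. Qed.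

Lemma lcontr_blade1 i K : lcontr (blade [set i]) (blade K) =
  if i \in K then shuffle_sign [set i] K *: blade (K :\ i) else 0.
Proof.
apply/ffunP => J; rewrite ffunE -mvvec_onb reversion_vec mvvec_onb wedge_blade1.
have [iJ|iJ] := boolP (i \in J).
  rewrite mvdotC mvdot0l; case: ifP => iK; last by rewrite mv0.
  rewrite mvZ bladeE; case: eqP => [E|_]; last by rewrite mulr0.
  by rewrite E !inE eqxx in iJ.
rewrite mvdotZr mvdot_bladel bladeE.
case: ifP => iK; last first.
  rewrite mv0; case: eqP => [E|_]; last by rewrite mulr0.
  by rewrite E !inE eqxx in iK.
rewrite mvZ bladeE; case: (J =P _) => [->|JK].
  by rewrite setD1K // eqxx shuffle_sign_setD1 // shuffle_sign_ii mul1r.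
case: eqP => [E|]; last by rewrite !mulr0.
by case: JK; rewrite E setU1K.
Qed.

Lemma lcontr_vec_wedge v w Y :
  lcontr (mvvec v) (wedge (mvvec w) Y) =
    g v w *: Y - wedge (mvvec w) (lcontr (mvvec v) Y).
Proof.
elim/mv_lin_ind: Y => [a Y Y' IH IH'|K].
  rewrite wedgePr !lcontrPr wedgePr IH IH' !scalerDr !scalerN !scalerA [_ * a]mulrC.
  by rewrite addrACA -opprD.
elim/vec_lin_ind: v => [a v v' IH IH'||i].
- rewrite mvvecP !lcontrPl wedgePr IH IH' dotDl dotZl scalerDl scalerBr !scalerA.
  by rewrite addrACA -opprD.
- by rewrite mvvec0 !lcontr0l wedge0r dot0l scale0r subrr.
elim/vec_lin_ind: w => [a v v' IH IH'||j].
- rewrite mvvecP !wedgePl lcontrPr IH IH' ![g (onb g i) _]dotC dotDl dotZl scalerDl scalerBr !scalerA.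
  by rewrite addrACA -opprD.
- by rewrite mvvec0 !wedge0l lcontr0r dotC dot0l scale0r subrr.
rewrite !mvvec_onb wedge_blade1 lcontr_blade1 onbE.
case: (i =P j) => [<-|/eqP ij].
  rewrite scale1r; case: ifP => iK; last first.
    rewrite lcontrZr lcontr_blade1 !inE eqxx /= wedge0r subr0 scalerA.
    by rewrite shuffle_sign_setU1 ?iK // shuffle_sign_ii mul1r shuffle_sign2 scale1r setU1K ?iK.
  rewrite wedgeZr wedge_blade1 !inE eqxx /= scalerA lcontr0r shuffle_sign_setD1 //.
  by rewrite shuffle_sign_ii mul1r shuffle_sign2 scale1r setD1K // subrr.
rewrite scale0r sub0r; case: ifP => jK.
  rewrite lcontr0r; case: ifP => iK; last by rewrite wedge0r oppr0.
  by rewrite wedgeZr wedge_blade1 !inE eq_sym ij jK /= scaler0 oppr0.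
rewrite lcontrZr lcontr_blade1 !inE (negPf ij) /=; case: ifP => iK; last by rewrite scaler0 wedge0r oppr0.
rewrite wedgeZr wedge_blade1 !inE jK andbF !scalerA.
rewrite shuffle_sign_setU1 ?jK // shuffle_sign_setD1 // -scaleNr.
have -> : (j |: K) :\ i = j |: (K :\ i).
  by apply/setP => k; rewrite !inE; case: eqP => // ->; rewrite (negPf ij).
congr (_ *: _); rewrite !shuffle_sign11; case: (ltngtP i j) => [_|_|/val_inj E]; [ring|ring|].
by rewrite E eqxx in ij.
Qed.

Lemma lcontr_vec_scalar v a : lcontr (mvvec v) (mvscalar a) = 0.
Proof.
rewrite /mvscalar lcontrZr; elim/vec_lin_ind: v => [b v v' IH IH'||i].
- by rewrite mvvecP lcontrPl scalerDr scalerA mulrC -scalerA IH IH' scaler0 addr0.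
- by rewrite mvvec0 lcontr0l scaler0.
- by rewrite mvvec_onb lcontr_blade1 inE scaler0.
Qed.

Lemma clifford_vec v X : clifford (mvvec v) X = lcontr (mvvec v) X + wedge (mvvec v) X.
Proof.
elim/mv_lin_ind: X => [a Y Y' IH IH'|K].
  by rewrite cliffordPr lcontrPr wedgePr IH IH' scalerDr addrACA.
elim/vec_lin_ind: v => [b v v' IH IH'||i].
- by rewrite mvvecP cliffordPl lcontrPl wedgePl IH IH' scalerDr addrACA.
- by rewrite mvvec0 clifford0l lcontr0l wedge0l addr0.
rewrite mvvec_onb clifford_blade lcontr_blade1 wedge_blade1.
case: ifP => iK; first by rewrite symdiff1_in // addr0.
by rewrite symdiff1_notin ?iK // add0r.
Qed.

Lemma clifford_unique (m : mv -> mv -> mv) :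
    (forall a X Y Z, m (a *: X + Y) Z = a *: m X Z + m Y Z) ->
    (forall a X Y Z, m X (a *: Y + Z) = a *: m X Y + m X Z) ->
    (forall X Y Z, m X (m Y Z) = m (m X Y) Z) ->
    (forall a X, m (mvscalar a) X = a *: X) ->
    (forall v X, m (mvvec v) X = lcontr (mvvec v) X + wedge (mvvec v) X) ->
  forall X Y, m X Y = clifford X Y.
Proof.
move=> mPl mPr mA m1 mv X Y; elim/mv_lin_ind: X => [a X X' IH IH'|I].
  by rewrite mPl cliffordPl IH IH'.
have mZl a Z Z' : m (a *: Z) Z' = a *: m Z Z'.
  have m0 : m 0 Z' = 0 by have := mPl (-1) Z Z Z'; rewrite !scaleN1r !addNr.
  by have := mPl a Z 0 Z'; rewrite m0 !addr0.
elim: {I}_.+1 {-2}I (ltnSn #|I|) Y => // k IHk I Ik Y.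
have [->|[i iI]] := set_0Vmem I.
  by have := m1 1 Y; have := clifford_scalarl 1 Y; rewrite /mvscalar !scale1r => -> ->.
have mE Z : m (blade [set i]) Z = clifford (blade [set i]) Z.
  by rewrite -mvvec_onb mv clifford_vec.
have -> : blade I = shuffle_sign [set i] (I :\ i) *:
    clifford (blade [set i]) (blade (I :\ i)).
  by rewrite clifford_blade scalerA shuffle_sign2 scale1r symdiff1_notin ?inE ?eqxx // setD1K.
rewrite mZl cliffordZl -cliffordA -{1}mE -mA mE IHk //.
by move: Ik; rewrite (cardsD1 i I) iI.
Qed.

Lemma blade_wedges I : blade I = mvwedges [seq onb g i | i <- enum I].
Proof.
have : sorted (fun i j : 'I_n => (i < j)%N) (enum I).
  rewrite {1}/enum_mem; apply: sorted_filter => [i j k|]; first exact: ltn_trans.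
  rewrite -enumT; have := iota_ltn_sorted 0 (\dim {:V}); rewrite -val_enum_ord sorted_map; exact: sub_sorted.
rewrite -{2}(set_enum I); elim: (enum I) => [|i s IH] /= Hs.
  rewrite /mvscalar scale1r; congr blade; by apply/setP => i; rewrite !inE.
rewrite /= -IH ?(path_sorted Hs) // mvvec_onb wedge_blade1.
have /allP Hall : all (fun j : 'I_n => (i < j)%N) s.
  by apply: order_path_min Hs => ? ? ?; exact: ltn_trans.
have -> : (i \in [set x in s]) = false.
  by rewrite inE; apply/negP => /Hall; rewrite ltnn.
have -> : shuffle_sign [set i] [set x in s] = 1.
  rewrite /shuffle_sign big_set1 big_pred0 // => j; rewrite inE.
  by case js : (j \in s) => //=; rewrite ltnNge ltnW // Hall.
rewrite scale1r; congr blade; apply/setP => j; by rewrite !inE.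
Qed.

Lemma mvwedges_rcons s v : mvwedges (rcons s v) = wedge (mvwedges s) (mvvec v).
Proof. by elim: s => [|w s IH] /=; rewrite ?wedge1l ?wedge1r // IH wedgeA. Qed.

Lemma shuffle_signC I J : [disjoint I & J] ->
  shuffle_sign I J = (-1) ^+ (#|I| * #|J|) * shuffle_sign J I.
Proof.
move=> IJ; suff <- : shuffle_sign I J * shuffle_sign J I = (-1) ^+ (#|I| * #|J|).
  by rewrite -mulrA shuffle_sign2 mulr1.
rewrite /shuffle_sign mulnC exprM -prodr_const.
under [X in _ * X]eq_bigr do rewrite big_mkcondr.
rewrite [X in _ * X]exchange_big -big_split /=; apply: eq_bigr => i iI.
rewrite big_mkcondr -big_split -prodr_const /=; apply: eq_bigr => j jJ.
case: (ltngtP i j) => [_|_|/val_inj E]; rewrite ?mul1r ?mulr1 //.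
by have := disjointFr IJ iI; rewrite E jJ.
Qed.

Lemma reversion_wedge X Y : reversion (wedge X Y) = wedge (reversion Y) (reversion X).
Proof.
elim/mv_lin_ind: X => [a X X' IH IH'|I]; first by rewrite !(wedgePl, wedgePr, reversionP) IH IH'.
elim/mv_lin_ind: Y => [a Y Y' IH IH'|J]; first by rewrite !(wedgePl, wedgePr, reversionP) IH IH'.
have rb K : reversion (blade K) = (-1) ^+ 'C(#|K|, 2) *: blade K.
  by apply/ffunP => L; rewrite mvZ !ffunE; case: eqP => [->|]; rewrite ?mulr0.
have rZ a X : reversion (a *: X) = a *: reversion X.
  by apply/ffunP => L; rewrite mvZ !ffunE mulrCA.
rewrite !rb wedgeZl wedgeZr !wedge_blade disjoint_sym; case: ifP => JI; last first.
  by rewrite !scaler0; apply/ffunP => K; rewrite ffunE mv0 mulr0.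
rewrite rZ rb setUC !scalerA; congr (_ *: _).
rewrite [shuffle_sign I J]shuffle_signC 1?disjoint_sym //.
have -> : 'C(#|J :|: I|, 2) = ('C(#|J|, 2) + 'C(#|I|, 2) + #|I| * #|J|)%N.
  have := cardsUI J I; move: (JI); rewrite -setI_eq0 => /eqP ->; rewrite cards0 addn0 => ->.
  rewrite addnC; elim: #|J| => [|k IHk]; first by rewrite addn0 muln0 bin0n addn0.
  by rewrite addnS binS IHk bin1 binS bin1 mulnS; lia.
have ss : (-1 : R) ^+ (#|I| * #|J|) * (-1) ^+ (#|I| * #|J|) = 1 by rewrite -expr2 sqrr_sign.
rewrite !exprD; move: ss; move: ((-1 : R) ^+ (#|I| * #|J|)) ((-1 : R) ^+ 'C(#|J|, 2)).
move: ((-1 : R) ^+ 'C(#|I|, 2)) (shuffle_sign J I) => a b s c ss.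
by transitivity (c * a * b * (s * s)); [ring|rewrite ss; ring].
Qed.

Lemma reversion_wedges s : reversion (mvwedges s) = mvwedges (rev s).
Proof.
elim: s => [|v s IH] /=; last by rewrite reversion_wedge IH reversion_vec rev_cons mvwedges_rcons.
apply/ffunP => I; rewrite ffunE /mvscalar mvZ bladeE; case: eqP => [->|]; last by rewrite !mulr0.
by rewrite cards0 mul1r.
Qed.

Lemma memv_gradeP (k : nat) X : reflect (forall I, X I != 0 -> #|I| = k) (X \in grade k).
Proof.
apply: (iffP idP) => [|H].
  case/memv_sumP => F HF -> I; rewrite mv_sum => HI; apply/eqP; apply: contraNT HI => Ik.
  rewrite big1 // => J Jk; have /vlineP[a ->] := HF J Jk.
  rewrite mvZ bladeE; case: eqP => [E|]; last by rewrite mulr0.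
  by rewrite E Jk in Ik.
rewrite (mv_expand X); apply: rpred_sum => I _.
have [->|/H Ik] := eqVneq (X I) 0; first by rewrite scale0r rpred0.
by apply/rpredZ/(subvP (sumv_sup I _ (subvv _))); [apply/eqP|rewrite memv_line].
Qed.

Lemma mvwedges_grade s : mvwedges s \in grade (size s).
Proof.
elim: s => [|v s IH] /=.
  apply/memv_gradeP => I; rewrite /mvscalar mvZ bladeE.
  by case: (I =P set0) => [->|_]; rewrite ?cards0 // mulr0 eqxx.
rewrite (mv_expand (mvwedges s)) wedge_sumr; apply: rpred_sum => K _; rewrite wedgeZr.
have [->|/(memv_gradeP _ _ IH) Ks] := eqVneq (mvwedges s K) 0; first by rewrite scale0r rpred0.
apply: rpredZ; elim/vec_lin_ind: v => [a v w Hv Hw||i].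
- by rewrite mvvecP wedgePl rpredD ?rpredZ.
- by rewrite mvvec0 wedge0l rpred0.
rewrite mvvec_onb wedge_blade1; case: ifP => iK; first exact: rpred0.
apply: rpredZ; apply/memv_gradeP => I; rewrite bladeE; case: (I =P _) => [-> _|_]; last by rewrite eqxx.
by rewrite cardsU1 iK Ks.
Qed.

Lemma mvdot_grade (j k : nat) X Y : j != k -> X \in grade j -> Y \in grade k -> mvdot X Y = 0.
Proof.
move=> jk /memv_gradeP HX /memv_gradeP HY; rewrite /mvdot big1 // => I _; apply/eqP.
rewrite mulf_eq0; apply: contraNT jk; rewrite negb_or => /andP[/HX <- /HY <-].
exact: eqxx.
Qed.

Lemma mvdot_scalar a b : mvdot (mvscalar a) (mvscalar b) = a * b.
Proof. by rewrite mvdotZl mvdotZr mvdot_bladel bladeE eqxx mulr1. Qed.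

Lemma mvwedges_ord k (w : 'I_k.+1 -> V) :
  mvwedges [seq w t | t <- enum 'I_k.+1] =
  wedge (mvvec (w ord0)) (mvwedges [seq w (lift ord0 t) | t <- enum 'I_k]).
Proof. by rewrite enum_ordSl /= -map_comp. Qed.

Lemma lcontr_vec_wedges k v (w : 'I_k.+1 -> V) :
  lcontr (mvvec v) (mvwedges [seq w t | t <- enum 'I_k.+1]) =
  \sum_(s < k.+1) ((-1) ^+ s * g v (w s)) *: mvwedges [seq w (lift s t) | t <- enum 'I_k].
Proof.
elim: k w => [|k IH] w; rewrite mvwedges_ord lcontr_vec_wedge.
  have -> : enum 'I_0 = [::] by apply: size0nil; rewrite size_enum_ord.
  by rewrite big_ord1 expr0 mul1r /= lcontr_vec_scalar wedge0r subr0.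
rewrite IH [in RHS]big_ord_recl expr0 mul1r; congr (_ + _).
rewrite wedge_sumr -sumrN; apply: eq_bigr => j _; rewrite wedgeZr -scaleNr exprS.
congr (_ *: _); first by rewrite -mulNr mulN1r.
rewrite [in RHS]mvwedges_ord; congr (wedge (mvvec (w _)) (mvwedges _)).
  exact: val_inj.
apply: eq_map => i; congr w; apply: val_inj => /=.
by rewrite /bump /= !add1n ltnS; case: leqP.
Qed.

Lemma mvdot_wedges k (v w : k.-tuple V) :
  mvdot (mvwedges v) (mvwedges w) = \det (\matrix_(s, t) g (tnth v s) (tnth w t)).
Proof.
rewrite -(map_tnth_enum v) -(map_tnth_enum w).
move: (tnth v) (tnth w) => {v w}; elim: k => [|k IH] v w.
  have -> : enum 'I_0 = [::] by apply: size0nil; rewrite size_enum_ord.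
  by rewrite det_mx00 mvdot_scalar mulr1.
rewrite mvwedges_ord mvdotC -{1}(reversion_vec (v ord0)).
have /= := lcontrP (mvvec (v ord0)) (mvwedges [seq w t | t <- enum 'I_k.+1])
  (mvwedges [seq v (lift ord0 t) | t <- enum 'I_k]) => <-.
rewrite lcontr_vec_wedges (expand_det_row _ ord0) mvdotC mvdot_sumr.
apply: eq_bigr => j _; rewrite mvdotZr IH /cofactor !mxE add0n mulrCA mulrA.
by congr (_ * \det _); apply/matrixP => a b; rewrite !mxE.
Qed.
End Multivectors.

From mathcomp Require Import all_classical topology normedtype.
Import numFieldNormedType.Exports.

Section MultivectorNorm.
Context {R : realType} {V : vectType R} {g : {dot V for idfun}}.
Local Notation mv := (multivector g).
Implicit Types X Y : mv.

Lemma mvdot_ge0 X : 0 <= mvdot X X.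
Proof. by apply: sumr_ge0 => I _; rewrite -expr2 sqr_ge0. Qed.

Lemma mvdot_eq0 X : (mvdot X X == 0) = (X == 0).
Proof.
apply/eqP/eqP => [|->]; last exact: mvdot0l.
move=> /eqP; rewrite psumr_eq0 => [/allP H|I _]; last by rewrite -expr2 sqr_ge0.
apply/ffunP => I; rewrite mv0; have := H I (mem_index_enum _).
by rewrite mulf_eq0 orbb => /eqP.
Qed.

Lemma mvdot_cauchy_schwarz X Y : mvdot X Y ^+ 2 <= mvdot X X * mvdot Y Y.
Proof.
have [->|Y0] := eqVneq Y 0; first by rewrite mvdotC !mvdot0l expr0n mulr0.
have YY : 0 < mvdot Y Y by rewrite lt_neqAle eq_sym mvdot_eq0 Y0 mvdot_ge0.
rewrite -(ler_pM2l YY) -subr_ge0.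
have := mvdot_ge0 (mvdot Y Y *: X + (- mvdot X Y) *: Y).
rewrite !(mvdotPl, mvdotPr) !(mvdotZl, mvdotZr) (mvdotC Y X).
by congr (0 <= _); ring.
Qed.

Lemma mvnormD X Y : mvnorm (X + Y) <= mvnorm X + mvnorm Y.
Proof.
rewrite -(@ler_pXn2r _ 2) ?nnegrE ?addr_ge0 ?sqrtr_ge0 // sqrrD !sqr_sqrtr ?mvdot_ge0 //.
have -> : mvdot (X + Y) (X + Y) = mvdot X X + mvdot X Y *+ 2 + mvdot Y Y.
  have D (A B C : mv) : mvdot (A + B) C = mvdot A C + mvdot B C.
    by rewrite -{1}[A]scale1r mvdotPl mul1r.
  by rewrite D !(mvdotC _ (X + Y)) !D (mvdotC Y X); ring.
rewrite lerD2r lerD2l lerMn2r /= -sqrtrM ?mvdot_ge0 //.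
by apply: le_trans (ler_norm _) _; rewrite -sqrtr_sqr ler_wsqrtr // mvdot_cauchy_schwarz.
Qed.

Lemma mvnormZ (a : R) X : mvnorm (a *: X) = `|a| * mvnorm X.
Proof.
rewrite /mvnorm mvdotZl mvdotZr mulrA -expr2 sqrtrM ?sqr_ge0 // sqrtr_sqr //.
Qed.

Lemma mvnorm_eq0 X : mvnorm X = 0 -> X = 0.
Proof.
by move/eqP; rewrite sqrtr_eq0 le_eqVlt ltNge mvdot_ge0 orbF mvdot_eq0 => /eqP.
Qed.

End MultivectorNorm.

HB.instance Definition _ (R : realType) (V : vectType R) (g : {dot V for idfun}) :=
  Lmodule_isNormed.Build R (multivector g) mvnormD mvnormZ mvnorm_eq0.

Definition kvector (R : realType) (V : vectType R) (g : {dot V for idfun}) (k : nat) :=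
  subvs_of (@grade R V g k).

HB.instance Definition _ (R : realType) (V : vectType R) (g : {dot V for idfun}) k :=
  Vector.on (kvector g k).

Definition mv_of_kvector (R : realType) (V : vectType R) (g : {dot V for idfun}) k
  (X : kvector g k) : multivector g := vsval X.
Coercion mv_of_kvector : kvector >-> multivector.

Lemma mvnormE (R : realType) (V : vectType R) (g : {dot V for idfun})
  (X : multivector g) : `|X| = mvnorm X.
Proof. by []. Qed.

Section KvectorNorm.
Context {R : realType} {V : vectType R} {g : {dot V for idfun}} {k : nat}.
Implicit Types X Y : kvector g k.

Let kvnorm X : R := mvnorm X.

Let kvnormD X Y : kvnorm (X + Y) <= kvnorm X + kvnorm Y.
Proof. exact: mvnormD. Qed.

Let kvnormZ (a : R) X : kvnorm (a *: X) = `|a| * kvnorm X.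
Proof. exact: mvnormZ. Qed.

Let kvnorm_eq0 X : kvnorm X = 0 -> X = 0.
Proof. by move/mvnorm_eq0 => X0; apply: val_inj. Qed.

HB.instance Definition _ :=
  Lmodule_isNormed.Build R (kvector g k) kvnormD kvnormZ kvnorm_eq0.

Lemma kvnormE X : `|X| = mvnorm X. Proof. by []. Qed.
End KvectorNorm.

Local Open Scope classical_set_scope.

(* F stands for a function defined on Omega: its values outside Omega play no role. *)
Definition is_differential (R : realType) (U W : normedModType R) (Omega : set U)
    (F : U -> W) (X0 : U) (f : U -> W) : Prop :=
  linear f /\
  (fun X => `|X - X0|^-1 *: (F X - F X0 - f (X - X0))) @ within Omega X0^' --> (0 : W).

Inductive mvproduct :=
  Exterior | Scalar | LeftContraction | RightContraction | Clifford.

Definition mvmul (R : realType) (V : vectType R) (g : {dot V for idfun})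
    (star : mvproduct) (X Y : multivector g) : multivector g :=
  match star with
  | Exterior => wedge X Y
  | Scalar => mvscalar (mvdot X Y)
  | LeftContraction => lcontr X Y
  | RightContraction => rcontr X Y
  | Clifford => clifford X Y
  end.

(* Main.v *)
Require Import Defs.
From HB Require Import structures.
From mathcomp Require Import all_boot all_order all_algebra.
From mathcomp Require Import sesquilinear reals ring.
From mathcomp Require Import all_classical topology normedtype.

Set Implicit Arguments.
Unset Strict Implicit.
Unset Printing Implicit Defensive.

Import Order.TTheory GRing.Theory Num.Theory.
Import numFieldNormedType.Exports.

Local Open Scope classical_set_scope.
Local Open Scope ring_scope.

(** Shrinking the set refines the filter along which the limit is taken. This moves both functions
    to their common domain. *)
Lemma is_differential_subset (R : realType) (U W : normedModType R)
    (Omega Omega' : set U) (F f : U -> W) (X0 : U) :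
  Omega' `<=` Omega -> is_differential Omega F X0 f -> is_differential Omega' F X0 f.
Proof.
move=> sub [lf hf]; split=> //; apply: cvg_trans hf.
by apply: cvg_app; exact: within_subset sub.
Qed.

Lemma is_differentialD (R : realType) (U W : normedModType R) (Omega : set U)
    (F G f h : U -> W) (X0 : U) :
  is_differential Omega F X0 f -> is_differential Omega G X0 h ->
  is_differential Omega (fun X => F X + G X) X0 (fun A => f A + h A).
Proof.
move=> [lf hf] [lh hh]; split=> [a u v|]; first by rewrite lf lh scalerDr addrACA.
have FF : Filter (within Omega X0^') by apply: within_filter; exact: dnbhs_filter.
rewrite -[0]addr0; apply: cvg_trans (cvgD hf hh).
apply: near_eq_cvg; apply: nearW => X; rewrite [LHS]/GRing.add /=.
rewrite -scalerDr !opprD; congr (_ *: _).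
by rewrite addrACA [in LHS](addrACA (F X)).
Qed.

(** The exact algebra of the product rule: [a] is the length of the displacement, [u], [v] are the
    linear parts of the increments and [r], [s] the rescaled remainders. In the last term [a^-1] is
    put into the second slot, which then stays bounded while the first slot is of order [a]. *)
Lemma bilinear_increment (R : fieldType) (U V W : lmodType R) (B : {bilinear U -> V -> W})
    (a : R) (x u r : U) (y v s : V) : a != 0 ->
  a^-1 *: (B (x + (u + a *: r)) (y + (v + a *: s)) - B x y - (B u y + B x v))
  = B r y + B x s + B (u + a *: r) (a^-1 *: v + s).
Proof.
move=> a0; have -> : a^-1 *: v + s = a^-1 *: (v + a *: s).
  by rewrite scalerDr scalerA mulVf // scale1r.
apply: (scalerI a0); rewrite linearZr_LR !scalerDr !scalerA mulfV // !scale1r.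
(* The product of the two increments occurs on both sides, so it is kept unexpanded. *)
set P := B (u + _) (v + _).
rewrite linearDl (linearDr B x) (linearDr B x) (linearDr B (u + _)) -/P (linearDl B y u).
rewrite !linearZl_LR !linearZr_LR /=.
apply/eqP; rewrite !subr_eq; apply/eqP.
by rewrite [LHS](AC (1*2*(2*1)) (5*3*6*(4*2)*1)).
Qed.

(* With [H = X - X0], the increment of [B (F X) (G X)] minus the proposed
   differential is [B (F X - F X0 - f H) (G X0) + B (F X0) (G X - G X0 - h H)
   + B (F X - F X0) (G X - G X0)], and the last term is [O(|H|^2)]. *)
Lemma is_differential_bilinear (R : realType) (U W1 W2 W : normedModType R)
    (Omega : set U) (B : {bilinear W1 -> W2 -> W}) (C Cf Ch : R)
    (F f : U -> W1) (G h : U -> W2) (X0 : U) :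
  (forall x y, `|B x y| <= C * `|x| * `|y|) ->
  (forall A, `|f A| <= Cf * `|A|) -> (forall A, `|h A| <= Ch * `|A|) ->
  is_differential Omega F X0 f -> is_differential Omega G X0 h ->
  is_differential Omega (fun X => B (F X) (G X)) X0
    (fun A => B (f A) (G X0) + B (F X0) (h A)).
Proof.
move=> HB Hf Hh [lf hf] [lh hh]; split=> [a u v|].
  by rewrite lf lh linearPl linearPr scalerDr addrACA.
pose rF X := `|X - X0|^-1 *: (F X - F X0 - f (X - X0)).
pose rG X := `|X - X0|^-1 *: (G X - G X0 - h (X - X0)).
have FF : Filter (within Omega X0^') by apply: within_filter; exact: dnbhs_filter.
rewrite -/rF in hf; rewrite -/rG in hh.
have expand (W' : normedModType R) (K k : U -> W') X : X != X0 ->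
    K X = K X0 + (k (X - X0) + `|X - X0| *: (`|X - X0|^-1 *: (K X - K X0 - k (X - X0)))).
  move=> XX0; rewrite scalerA mulfV ?normr_eq0 ?subr_eq0 // scale1r.
  by rewrite [k _ + _]addrC subrK addrC subrK.
(* One summand for each term of [bilinear_increment]. Since [C] may be negative, the last summand
   uses its absolute value, so that its other factors can be enlarged. *)
pose bound X := C * `|rF X| * `|G X0| + C * `|F X0| * `|rG X|
  + `|C| * (Cf + `|rF X|) * (Ch + `|rG X|) * `|X - X0|.
have bound0 : bound @ within Omega X0^' --> (0 : R).
  have H0 : (fun X => `|X - X0|) @ within Omega X0^' --> (0 : R).
    have : (fun X => `|X - X0|) @ X0 --> `|X0 - X0|.
      by apply: cvg_norm; apply: cvgB; [exact: cvg_id|exact: cvg_cst].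
    rewrite subrr normr0; apply: cvg_trans; apply: cvg_app.
    apply: cvg_trans (@cvg_within _ _ _ _) _; exact: cvg_within.
  have rF0 := cvg_norm (FF := FF) hf; have rG0 := cvg_norm (FF := FF) hh.
  rewrite !normr0 in rF0 rG0.
  (* Zero is written in the shape of [bound], with each vanishing quantity replaced by its limit. *)
  have -> : (0 : R) = C * 0 * `|G X0| + C * `|F X0| * 0
     + `|C| * (Cf + 0) * (Ch + 0) * 0 by rewrite !(mulr0, mul0r, addr0).
  apply: cvgD; first apply: cvgD.
  - apply: cvgM; last exact: cvg_cst.
    by apply: cvgM; first exact: cvg_cst.
  - by apply: cvgM; first exact: cvg_cst.
  - apply: cvgM => //; apply: cvgM.
      by apply: cvgM; [exact: cvg_cst|apply: cvgD => //; exact: cvg_cst].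
    by apply: cvgD => //; exact: cvg_cst.
apply/norm_cvg0P; apply: (squeeze_cvgr _ (cvg_cst 0) bound0).
(* The neighbourhoods are punctured, so dividing by the length of [X - X0] is legitimate. *)
have ne : \forall X \near within Omega X0^', X != X0.
  by do 2 rewrite near_withinE; exact: nearW.
apply: filterS ne => X XX0; rewrite normr_ge0 /=.
set H := X - X0.
have -> : `|H|^-1 *: (B (F X) (G X) - B (F X0) (G X0) - (B (f H) (G X0) + B (F X0) (h H)))
   = B (rF X) (G X0) + B (F X0) (rG X)
     + B (f H + `|H| *: rF X) (`|H|^-1 *: h H + rG X).
  have a0 : `|H| != 0 by rewrite normr_eq0 subr_eq0.
  by rewrite (expand _ F f X XX0) (expand _ G h X XX0) bilinear_increment.
apply: le_trans (ler_normD _ _) _; apply: lerD.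
  by apply: le_trans (ler_normD _ _) _; apply: lerD.
have C0 x y : `|B x y| <= `|C| * `|x| * `|y|.
  apply: le_trans (HB x y) _; rewrite -!mulrA ler_wpM2r ?mulr_ge0 //; exact: ler_norm.
apply: le_trans (C0 _ _) _.
(* The factor from [H] is attached to the first slot; in the second slot it cancels against its
   inverse. *)
have -> : `|C| * (Cf + `|rF X|) * (Ch + `|rG X|) * `|H|
   = `|C| * ((Cf + `|rF X|) * `|H|) * (Ch + `|rG X|) by ring.
rewrite -2!mulrA ler_wpM2l // ler_pM //.
  apply: le_trans (ler_normD _ _) _; rewrite normrZ normr_id mulrDl.
  by rewrite [`|H| * _]mulrC lerD.
apply: le_trans (ler_normD _ _) _; rewrite lerD2r normrZ normfV normr_id.
by rewrite mulrC ler_pdivrMr // normr_gt0 subr_eq0.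
Qed.

Section Boundedness.
Context {R : realType} {V : vectType R} {g : {dot V for idfun}}.
Local Notation mv := (multivector g).

(** Bilinearity is all that the product rule needs to know about the five products, so this is the
    only case analysis on [star]. *)
Lemma mvmul_bilinear (star : mvproduct) : bilinear_for
  (GRing.Scale.Law.clone _ _ *:%R _) (GRing.Scale.Law.clone _ _ *:%R _)
  (@mvmul R V g star).
Proof.
split=> Z a X Y; case: star => /=.
- exact: wedgePl.
- by rewrite mvdotPl /mvscalar scalerDl scalerA.
- exact: lcontrPl.
- exact: rcontrPl.
- exact: cliffordPl.
- exact: wedgePr.
- by rewrite mvdotPr /mvscalar scalerDl scalerA.
- exact: lcontrPr.
- exact: rcontrPr.
- exact: cliffordPr.
Qed.

HB.instance Definition _ star :=
  bilinear_isBilinear.Build R mv mv mv _ _ (@mvmul R V g star) (mvmul_bilinear star).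

Lemma normr_coef_le (X : mv) I : `|X I| <= `|X|.
Proof.
rewrite mvnormE /mvnorm -sqrtr_sqr ler_wsqrtr // /mvdot (bigD1 I) //= expr2 lerDl.
by apply: sumr_ge0 => J _; rewrite -expr2 sqr_ge0.
Qed.

(** There are finitely many blades, and no coefficient of [X] exceeds the norm of [X]; hence the
    norms of the images of the blades sum to a valid constant. *)
Lemma multivector_linear_bounded (W : normedModType R) (f : {linear mv -> W}) :
  exists C, forall X, `|f X| <= C * `|X|.
Proof.
exists (\sum_I `|f (blade I)|) => X.
rewrite {1}(mv_expand X) linear_sum mulr_suml; apply: le_trans (ler_norm_sum _ _ _) _.
by apply: ler_sum => I _; rewrite linearZ normrZ mulrC ler_wpM2l // normr_coef_le.
Qed.

Lemma multivector_bilinear_bounded (W : normedModType R) (B : {bilinear mv -> mv -> W}) :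
  exists C, forall X Y, `|B X Y| <= C * `|X| * `|Y|.
Proof.
exists (\sum_I \sum_J `|B (blade I) (blade J)|) => X Y.
rewrite {1}(mv_expand X) linear_sumlz -mulrA mulr_suml.
apply: le_trans (ler_norm_sum _ _ _) _; apply: ler_sum => I _.
rewrite linearZl_LR {1}(mv_expand Y) linear_sumr mulr_suml scaler_sumr.
apply: le_trans (ler_norm_sum _ _ _) _; apply: ler_sum => J _.
rewrite linearZr_LR !normrZ mulrA [leRHS]mulrC ler_wpM2r //.
by apply: ler_pM => //; apply: normr_coef_le.
Qed.

(* Composing with the linear projection [vsproj] extends [f] to all multivectors. *)
Lemma kvector_linear_bounded p (W : normedModType R) (f : kvector g p -> W) :
  linear f -> exists C, forall A, `|f A| <= C * `|A|.
Proof.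
move=> lf; pose f' (X : mv) := f (vsproj (grade p) X).
have lf' : linear f' by move=> a X Y; rewrite /f' linearP lf.
pose fL : {linear mv -> W} := HB.pack f' (GRing.isLinear.Build _ _ _ _ f' lf').
have [C HC] := multivector_linear_bounded fL.
by exists C => A; have := HC (mv_of_kvector A); rewrite /= /f' vsvalK.
Qed.

(** Products leave the grade [q], so the factors must be seen as multivector-valued. The norm of a
    [kvector] is that of its underlying multivector, so the limit is unchanged. *)
Lemma is_differential_coe (U : normedModType R) q (Omega : set U)
    (K k : U -> kvector g q) X0 : is_differential Omega K X0 k ->
  is_differential Omega (fun X => K X : mv) X0 (fun A => k A : mv).
Proof.
move=> [lk hk]; split=> [a u v|]; first by rewrite lk /mv_of_kvector linearP.
have FF : Filter (within Omega X0^') by apply: within_filter; exact: dnbhs_filter.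
by apply/norm_cvg0P; move/norm_cvg0P: hk.
Qed.

End Boundedness.

Theorem theorem4 (R : realType) (V : vectType R) (g : {dot V for idfun}) (p q : nat)
    (hp : (p <= \dim {:V})%N) (hq : (q <= \dim {:V})%N)
    (Omega1 Omega2 : set (kvector g p))
    (open1 : open Omega1) (open2 : open Omega2)
    (meet12 : Omega1 `&` Omega2 !=set0)
    (F G : kvector g p -> kvector g q)
    (X0 : kvector g p) (hX0 : (Omega1 `&` Omega2) X0)
    (f g' : kvector g p -> kvector g q)
    (hF : is_differential Omega1 F X0 f)
    (hG : is_differential Omega2 G X0 g') :
  is_differential (Omega1 `&` Omega2)
      (fun X => F X + G X) X0 (fun A => f A + g' A)
  /\ (forall star : mvproduct,
      is_differential (Omega1 `&` Omega2)
        (fun X => mvmul star (F X) (G X)) X0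
        (fun A => mvmul star (f A) (G X0) + mvmul star (F X0) (g' A))).
Proof.
have hF' := is_differential_subset (@subIsetl _ Omega1 Omega2) hF.
have hG' := is_differential_subset (@subIsetr _ Omega1 Omega2) hG.
split=> [|star]; first exact: is_differentialD.
have [C HC] := multivector_bilinear_bounded (@mvmul R V g star).
have [Cf Hf] := kvector_linear_bounded hF.1.
have [Cg Hg] := kvector_linear_bounded hG.1.
(* [Hf] and [Hg] also bound the coerced differentials, because the two norms agree by definition. *)
apply: (is_differential_bilinear HC Hf Hg); exact: is_differential_coe.
Qed.
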